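(* Let $1\le n\le N$. For every $x$ at which $\mathscr C_{1,n}(x)$ and $\mathscr D_{1,n}(x)$ are defined, $\mathscr D_{1,n}(x)\neq0$, and $f_n(x)-1\notin\{0,-1,\dots,-(n-1)\}$, where $$f_n(x)=\frac{np(N-n+1)\,\mathscr C_{1,n}(x)}{\mathscr D_{1,n}(x)}-n+1,$$ one has $$\mathbb K_n(x)=p^{n-1}(-N)_{n-1}\,h_n(x)\sum_{k=0}^{n}\frac{(-n)_k(-x)_k\,(f_n(x))_k}{(-N)_k\,(f_n(x)-1)_k}\frac{p^{-k}}{k!},\qquad h_n(x)=-\big(p(N-n+1)\,\mathscr C_{1,n}(x)-\mathscr D_{1,n}(x)\big),$$ i.e. $\mathbb K_n(x)=p^{n-1}(-N)_{n-1}h_n(x)\,{}_3F_2\!\left(-n,-x,f_n(x);-N,f_n(x)-1;p^{-1}\right)$ (terminating series).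
   Context: Fix an integer $N\ge 1$ and $0<p<1$. Notation: $(a)_0=1$, $(a)_k=a(a+1)\cdots(a+k-1)$ (Pochhammer symbol); $[z]_0=1$, $[z]_k=z(z-1)\cdots(z-k+1)$ (falling factorial). For a function $f$, $\Delta f(x)=f(x+1)-f(x)$, $\nabla f(x)=f(x)-f(x-1)$, $\Delta^0$ is the identity and $\Delta^k=\Delta\circ\Delta^{k-1}$. For $0\le n\le N$ the monic Kravchuk polynomial is $K_n(x)=p^n(-N)_n\sum_{k=0}^{n}\frac{(-n)_k(-x)_k}{(-N)_k\,k!}p^{-k}$, and $K_{-1}=0$; these are monic of degree $n$ and orthogonal on $\{0,\dots,N\}$ with respect to the binomial weight $w(x)=\binom{N}{x}p^x(1-p)^{N-x}$, with $\|K_n\|^2=\sum_{x=0}^N K_n(x)^2w(x)=n!(-N)_np^n(p-1)^n$. For $1\le n\le N+1$ and integers $i,l\ge0$, $\mathscr K_{n-1}^{(i,l)}(x,y)=\sum_{k=0}^{n-1}\frac{\Delta^iK_k(x)\,\Delta^lK_k(y)}{\|K_k\|^2}$. Fix $\lambda,\mu>0$ and an integer $j\ge 0$. On real polynomials define $\langle f,g\rangle_{\lambda,\mu}=\sum_{x=0}^N f(x)g(x)w(x)+\lambda\Delta^jf(0)\Delta^jg(0)+\mu\Delta^jf(N)\Delta^jg(N)$. For $0\le n\le N$, $\mathbb K_n=\mathbb K_n^{(j)}$ is the monic polynomial of degree $n$ with $\langle\mathbb K_n,q\rangle_{\lambda,\mu}=0$ for all polynomials $q$ of degree $<n$ (Kravchuk–Sobolev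 polynomials). For $1\le n\le N$: $\mathscr A_n(x,y)=\frac{j!}{\|K_{n-1}\|^2[x-y]_{j+1}}\sum_{k=0}^{j}\frac{\Delta^kK_{n-1}(y)}{k!}[x-y]_k$, $\mathscr B_n(x,y)=-\frac{j!}{\|K_{n-1}\|^2[x-y]_{j+1}}\sum_{k=0}^{j}\frac{\Delta^kK_{n}(y)}{k!}[x-y]_k$; $k_{00}=\mathscr K^{(j,j)}_{n-1}(0,0)$, $k_{0N}=\mathscr K^{(j,j)}_{n-1}(0,N)$, $k_{N0}=\mathscr K^{(j,j)}_{n-1}(N,0)$, $k_{NN}=\mathscr K^{(j,j)}_{n-1}(N,N)$, $d_0=\Delta^jK_n(0)$, $d_N=\Delta^jK_n(N)$, $\delta_n=(1+\lambda k_{00})(1+\mu k_{NN})-\lambda\mu k_{0N}k_{N0}$ (which is nonzero), $\Phi_1(n)=\frac{d_0(1+\mu k_{NN})-\mu k_{0N}d_N}{\delta_n}$, $\Phi_2(n)=\frac{(1+\lambda k_{00})d_N-\lambda k_{N0}d_0}{\delta_n}$; $\mathscr C_{1,n}(x)=1-\lambda\Phi_1(n)\mathscr A_n(x,0)-\mu\Phi_2(n)\mathscr A_n(x,N)$ and $\mathscr D_{1,n}(x)=-\lambda\Phi_1(n)\mathscr B_n(x,0)-\mu\Phi_2(n)\mathscr B_n(x,N)$. *)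

(* Defs.v *)
From mathcomp Require Import all_boot all_order all_algebra.
Set Implicit Arguments. Unset Strict Implicit. Unset Printing Implicit Defensive.
Import Order.TTheory GRing.Theory Num.Theory.
Local Open Scope ring_scope.

Section KS.
Variable R : realFieldType.

Definition poch (a : R) (k : nat) : R := \prod_(i < k) (a + i%:R).
Definition ffact (z : R) (k : nat) : R := \prod_(i < k) (z - i%:R).
Definition fdiff (f : R -> R) : R -> R := fun x => f (x + 1) - f x.
Definition fdiffn (k : nat) (f : R -> R) : R -> R := iter k fdiff f.

Definition wbin (N : nat) (p : R) (x : nat) : R :=
  'C(N, x)%:R * p ^+ x * (1 - p) ^+ (N - x).

(* monic Kravchuk polynomial K_n (as a function of real x), 0 <= n <= N *)
Definition Kraw (N : nat) (p : R) (n : nat) (x : R) : R :=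
  p ^+ n * poch (- N%:R) n *
  \sum_(k < n.+1) (poch (- n%:R) k * poch (- x) k / (poch (- N%:R) k * k`!%:R))
                    * p ^- k.

Definition knorm2 (N : nat) (p : R) (n : nat) : R :=
  \sum_(x < N.+1) Kraw N p n x%:R ^+ 2 * wbin N p x.

(* kernel  \mathscr K^{(i,l)}_{n-1}(x,y) = sum_{k=0}^{n-1} ... *)
Definition kern (N : nat) (p : R) (n i l : nat) (x y : R) : R :=
  \sum_(k < n) fdiffn i (Kraw N p k) x * fdiffn l (Kraw N p k) y / knorm2 N p k.

Definition sobip (N : nat) (p lam mu : R) (j : nat) (f g : {poly R}) : R :=
  \sum_(x < N.+1) f.[x%:R] * g.[x%:R] * wbin N p x
  + lam * fdiffn j (horner f) 0 * fdiffn j (horner g) 0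
  + mu * fdiffn j (horner f) N%:R * fdiffn j (horner g) N%:R.

Definition scrA (N : nat) (p : R) (j n : nat) (x y : R) : R :=
  j`!%:R / (knorm2 N p n.-1 * ffact (x - y) j.+1) *
  \sum_(k < j.+1) fdiffn k (Kraw N p n.-1) y / k`!%:R * ffact (x - y) k.

Definition scrB (N : nat) (p : R) (j n : nat) (x y : R) : R :=
  - (j`!%:R / (knorm2 N p n.-1 * ffact (x - y) j.+1)) *
  \sum_(k < j.+1) fdiffn k (Kraw N p n) y / k`!%:R * ffact (x - y) k.

Definition k00 N p j n := kern N p n j j 0 0.
Definition k0N N p j n := kern N p n j j 0 N%:R.
Definition kN0 N p j n := kern N p n j j N%:R 0.
Definition kNN N p j n := kern N p n j j N%:R N%:R.
Definition d0 N p j n := fdiffn j (Kraw N p n) 0.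
Definition dN N p j n := fdiffn j (Kraw N p n) N%:R.

Definition deltan N p (lam mu : R) j n : R :=
  (1 + lam * k00 N p j n) * (1 + mu * kNN N p j n) - lam * mu * k0N N p j n * kN0 N p j n.

Definition Phi1 N p (lam mu : R) j n : R :=
  (d0 N p j n * (1 + mu * kNN N p j n) - mu * k0N N p j n * dN N p j n)
  / deltan N p lam mu j n.

Definition Phi2 N p (lam mu : R) j n : R :=
  ((1 + lam * k00 N p j n) * dN N p j n - lam * kN0 N p j n * d0 N p j n)
  / deltan N p lam mu j n.

Definition C1 N p (lam mu : R) j n (x : R) : R :=
  1 - lam * Phi1 N p lam mu j n * scrA N p j n x 0
    - mu * Phi2 N p lam mu j n * scrA N p j n x N%:R.

Definition D1 N p (lam mu : R) j n (x : R) : R :=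
  - lam * Phi1 N p lam mu j n * scrB N p j n x 0
  - mu * Phi2 N p lam mu j n * scrB N p j n x N%:R.

Definition fn N p (lam mu : R) j n (x : R) : R :=
  n%:R * p * (N%:R - n%:R + 1) * C1 N p lam mu j n x / D1 N p lam mu j n x
  - n%:R + 1.

Definition hn N p (lam mu : R) j n (x : R) : R :=
  - (p * (N%:R - n%:R + 1) * C1 N p lam mu j n x - D1 N p lam mu j n x).

End KS.

(* Main.v *)
(** The Kravchuk-Sobolev polynomial differs from [K_n] by a combination of the
    kernels [K^(0,j)_(n-1)(x, 0)] and [K^(0,j)_(n-1)(x, N)], whose coefficients
    solve a 2x2 linear system with determinant [deltan]. The difference operator
    applied [j] times to the Christoffel-Darboux formula writes those kernels in
    terms of [K_n] and [K_(n-1)], so that the polynomial equals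
    [C1 * K_n + D1 * K_(n-1)]. Since [(f)_k / (f - 1)_k = 1 + k / (f - 1)], the
    terminating series splits into the same combination, term by term. *)

Require Import Defs.
From mathcomp Require Import all_boot all_order all_algebra ring.
Import Order.TTheory GRing.Theory Num.Theory.
Local Open Scope ring_scope.
Set Implicit Arguments.
Unset Strict Implicit.

(** * Iterated forward differences and division by [x - y] *)

Local Arguments fdiffn {R} k f x : simpl never.

Lemma fdiffn_ext (R : realFieldType) (k : nat) (f g : R -> R) :
  f =1 g -> fdiffn k f =1 fdiffn k g.
Proof.
move=> efg; elim: k => [|k IHk] x; first exact: efg.
by rewrite /fdiffn /= -!/(fdiffn k _) /fdiff !IHk.
Qed.

Lemma fdiffn0 (R : realFieldType) (f : R -> R) (x : R) : fdiffn 0 f x = f x.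
Proof. by []. Qed.

Lemma fdiffnS (R : realFieldType) (k : nat) (f : R -> R) (x : R) :
  fdiffn k.+1 f x = fdiffn k f (x + 1) - fdiffn k f x.
Proof. by []. Qed.

Lemma fdiffn_linear (R : realFieldType) (k : nat) (a : R) (f g : R -> R) (x : R) :
  fdiffn k (fun y => a * f y + g y) x = a * fdiffn k f x + fdiffn k g x.
Proof.
elim: k x => [|k IHk] x //.
by rewrite !fdiffnS !IHk; ring.
Qed.

Lemma fdiffn_sum (R : realFieldType) (k n : nat) (a : nat -> R)
    (f : nat -> R -> R) (x : R) :
  fdiffn k (fun y => \sum_(i < n) a i * f i y) x = \sum_(i < n) a i * fdiffn k (f i) x.
Proof.
elim: n => [|n IHn].
  rewrite big_ord0 (@fdiffn_ext R k _ (fun=> 0)); last by move=> y; rewrite big_ord0.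
  by elim: k x => [|k IHk] x //; rewrite fdiffnS !IHk subrr.
rewrite big_ord_recr /= -IHn addrC -fdiffn_linear.
by apply: fdiffn_ext => y; rewrite big_ord_recr /= addrC.
Qed.

Lemma ffactS (R : realFieldType) (z : R) (k : nat) :
  ffact z k.+1 = ffact z k * (z - k%:R).
Proof. by rewrite /ffact big_ord_recr. Qed.

Lemma pochS (R : realFieldType) (z : R) (k : nat) :
  poch z k.+1 = poch z k * (z + k%:R).
Proof. by rewrite /poch big_ord_recr. Qed.

(** The discrete Leibniz rule for [(x - y) * g y]: only two terms survive, because the linear factor
    has vanishing second difference. *)
Lemma fdiffn_subM (R : realFieldType) (x : R) (f g : R -> R) :
  (forall y, (x - y) * g y = f y) ->
  forall k y, fdiffn k.+1 f y =
    (x - y - k.+1%:R) * fdiffn k.+1 g y - k.+1%:R * fdiffn k g y.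
Proof.
move=> fg; elim=> [|k IHk] y.
  by rewrite !fdiffnS !fdiffn0 -!fg; ring.
by rewrite fdiffnS !IHk !fdiffnS -[k.+2]addn1 -[k.+1]addn1 !natrD; ring.
Qed.

(* Stated without division, so that no point y has to be excluded from the
   induction. *)
Lemma fdiffn_quotient (R : realFieldType) (x : R) (f g : R -> R) :
  (forall y, (x - y) * g y = f y) ->
  forall j y, ffact (x - y) j.+1 * fdiffn j g y =
    j`!%:R * \sum_(k < j.+1) fdiffn k f y / k`!%:R * ffact (x - y) k.
Proof.
move=> fg; elim=> [|j IHj] y.
  by rewrite big_ord1 /ffact big_ord1 big_ord0 /= fact0 !fdiffn0 -fg; field.
(* The new top summand is expanded by [fdiffn_subM]; its part in [fdiffn j g y] cancels the shorter
   sum, which the induction hypothesis evaluates. *)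
rewrite big_ord_recr /= ffactS (fdiffn_subM fg) factS natrM.
move: (IHj y); move: (\sum_(k < j.+1) _) => S E.
rewrite [_ * (S + _)]mulrDr -[_ * j`!%:R * S]mulrA -E.
have : j.+1%:R != 0 :> R by rewrite pnatr_eq0.
have : j`!%:R != 0 :> R by rewrite pnatr_eq0 -lt0n fact_gt0.
by move: (j.+1%:R) (j`!%:R) => a b h1 h2; field; rewrite ?h1 ?h2.
Qed.

(** * Alternating binomial sums and factorial moments of the binomial weight *)

Lemma poch_oppn (R : realFieldType) (n k : nat) :
  poch (- n%:R : R) k = (-1) ^+ k * (n ^_ k)%:R.
Proof.
elim: k => [|k IHk]; first by rewrite /poch big_ord0 expr0 mul1r.
rewrite pochS IHk ffactnSr exprS natrM.
case: (leqP k n) => h; first by rewrite natrB //; ring.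
by rewrite ffact_small //; ring.
Qed.

Lemma poch_oppn_neq0 (R : realFieldType) (n k : nat) :
  (k <= n)%N -> poch (- n%:R : R) k != 0.
Proof.
move=> h; rewrite poch_oppn mulf_neq0 ?expf_neq0 ?oppr_eq0 ?oner_eq0 //.
by rewrite pnatr_eq0 -lt0n ffact_gt0.
Qed.

Lemma ffactnD (n k m : nat) : (n ^_ (k + m) = n ^_ k * (n - k) ^_ m)%N.
Proof.
elim: m => [|m IHm]; first by rewrite addn0 muln1.
by rewrite addnS !ffactnSr IHm mulnA subnDA.
Qed.

(** An [n]-th finite difference annihilates a polynomial in [k] of degree [m < n]. The bound
    [n <= N] ensures that the truncated subtraction [N - k] is a true one. *)
Lemma alternating_bin_sum (R : realFieldType) (n N m : nat) :
  (m < n)%N -> (n <= N)%N ->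
  \sum_(k < n.+1) (-1) ^+ k * 'C(n, k)%:R * 'C(N - k, m)%:R = 0 :> R.
Proof.
elim: n N m => [|n IHn] [|N] m //= lt_mn le_nN.
(* Pascal's rule and a shift of index trade one order of the difference for the increments of [f];
   for a binomial coefficient these lower [m] by one. *)
have pascal (f : nat -> R) :
    \sum_(k < n.+2) (-1) ^+ k * 'C(n.+1, k)%:R * f k =
    \sum_(k < n.+1) (-1) ^+ k * 'C(n, k)%:R * (f k - f k.+1).
  under [RHS]eq_bigr do rewrite mulrBr.
  rewrite sumrB big_ord_recl /= bin0.
  under eq_bigr => i _ do
    rewrite /bump add1n binS natrD exprS mulrDr mulrDl mulN1r !mulNr.
  rewrite big_split /= !sumrN addrA; congr (_ - _).
  rewrite [in LHS]big_ord_recr [in RHS]big_ord_recl /= bin0 bin_small //.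
  rewrite mulr0 mul0r addr0 -sumrN; congr (_ + _).
  by apply: eq_bigr => i _; rewrite /bump add1n exprS; ring.
rewrite (pascal (fun k => 'C(N.+1 - k, m)%:R)).
case: m lt_mn => [|m] lt_mn.
  by rewrite big1 // => i _; rewrite !bin0 subrr mulr0.
rewrite -[RHS](IHn N m) //; apply: eq_bigr => -[k] /= lt_k _.
have le_kN : (k <= N)%N := leq_trans lt_k le_nN.
by rewrite subSS subSn ?binS ?natrD ?(addrC _ (binomial _ m)%:R) ?addrK.
Qed.

(** The absorption identities for ['C(N, x)] peel off one factor [x] or [N - x] at a time and lower
    [N] by one. With no factor left, the sum is the binomial expansion of [(1 - p + p) ^+ N]. *)
Lemma wbin_moment (R : realFieldType) (p : R) (N k m : nat) :
  \sum_(x < N.+1) (x ^_ k)%:R * ((N - x) ^_ m)%:R * wbin N p x =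
  (N ^_ (k + m))%:R * p ^+ k * (1 - p) ^+ m.
Proof.
elim: k N => [|k IHk] N; last first.
  case: N => [|N].
    by rewrite big_ord1 ffact0n ffact_small // !mul0r.
  rewrite big_ord_recl ffact0n /= !mul0r add0r addSn ffactSS natrM exprS.
  transitivity (N.+1%:R * p * ((N ^_ (k + m))%:R * p ^+ k * (1 - p) ^+ m));
    last by ring.
  rewrite -IHk mulr_sumr; apply: eq_bigr => i _.
  rewrite /bump add1n subSS ffactSS /wbin subSS exprS natrM.
  have := mul_bin_diag N.+1 i => /= /(congr1 (fun a => a%:R : R)); rewrite !natrM => E.
  transitivity ((i.+1%:R * 'C(N.+1, i.+1)%:R) * p * (i ^_ k)%:R *
    ((N - i) ^_ m)%:R * p ^+ i * (1 - p) ^+ (N - i)); first by ring.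
  by rewrite -E; ring.
under eq_bigr do rewrite ffactn0 mul1r.
rewrite add0n expr0 mulr1.
elim: m N => [|m IHm] N.
  have E : (1 - p + p) ^+ N = 1 by rewrite subrK expr1n.
  rewrite expr0 !mulr1 ffactn0 -[RHS]E exprDn.
  by apply: eq_bigr => i _; rewrite /wbin ffactn0 -mulr_natl; ring.
case: N => [|N].
  by rewrite big_ord1 ffact0n /= !mul0r.
rewrite big_ord_recr /= subnn ffact0n /= mul0r addr0 ffactSS natrM exprS.
transitivity (N.+1%:R * (1 - p) * ((N ^_ m)%:R * (1 - p) ^+ m)); last by ring.
rewrite -IHm mulr_sumr; apply: eq_bigr => -[i] /= lt_i _.
rewrite subSn // ffactSS /wbin subSn // exprS natrM.
have := mul_bin_down N.+1 i => /= /(congr1 (fun a => a%:R : R)).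
rewrite !natrM subSn // => E.
transitivity (((N - i).+1%:R * 'C(N.+1, i)%:R) * (1 - p) *
  ((N - i) ^_ m)%:R * p ^+ i * (1 - p) ^+ (N - i)); first by ring.
by rewrite -E; ring.
Qed.

(** * Kravchuk polynomials as elements of [{poly R}] *)

(** The sign of the factors is chosen so that [c i = i] gives the Pochhammer symbol of [- x], and
    [c i = N - i] the falling factorial of [N - x]. *)
Definition nodal (R : realFieldType) (c : nat -> R) (m : nat) : {poly R} :=
  \prod_(i < m) ((c i)%:P - 'X).

Lemma nodalE (R : realFieldType) (c : nat -> R) (m : nat) :
  nodal c m = (-1) ^+ m *: \prod_(i < m) ('X - (c i)%:P).
Proof.
rewrite /nodal; elim: m => [|m IHm]; first by rewrite !big_ord0 expr0 scale1r.
rewrite !big_ord_recr /= IHm exprS mulN1r scaleNr -scalerAl -scalerN -mulrN.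
by rewrite opprB.
Qed.

Lemma size_nodal (R : realFieldType) (c : nat -> R) (m : nat) :
  size (nodal c m) = m.+1.
Proof.
rewrite nodalE size_scale ?expf_neq0 ?oppr_eq0 ?oner_eq0 //.
by rewrite size_prod_XsubC /index_enum unlock -enumT size_enum_ord.
Qed.

Lemma lead_coef_nodal (R : realFieldType) (c : nat -> R) (m : nat) :
  lead_coef (nodal c m) = (-1) ^+ m.
Proof.
by rewrite nodalE lead_coefZ (monicP (monic_prod_XsubC _ _ _)) mulr1.
Qed.

Definition Kpoly (R : realFieldType) (N : nat) (p : R) (n : nat) : {poly R} :=
  \sum_(k < n.+1) (p ^+ n * poch (- N%:R) n *
    (poch (- n%:R) k / (poch (- N%:R) k * k`!%:R) * p ^- k)) *:
      nodal (fun i => i%:R) k.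

Lemma horner_Kpoly (R : realFieldType) (N : nat) (p : R) (n : nat) (x : R) :
  (Kpoly N p n).[x] = Kraw N p n x.
Proof.
rewrite horner_sum /Kraw mulr_sumr; apply: eq_bigr => k _.
rewrite hornerZ /nodal horner_prod /poch.
under eq_bigr do rewrite !hornerE addrC.
by ring.
Qed.

Lemma size_sum_nodal (R : realFieldType) (n : nat) (c : nat -> R) :
  (size (\sum_(k < n) c k *: nodal (fun i => i%:R) k)%R <= n)%N.
Proof.
apply: leq_trans (size_sum _ _ _) _; apply/bigmax_leqP => -[i lt_in] _ /=.
by apply: leq_trans (size_scale_leq _ _) _; rewrite size_nodal.
Qed.

(** Only the summand [k = n] reaches degree [n]. Its coefficient is [(-1) ^+ n], because
    [poch (- n%:R) n] equals [(-1) ^+ n * n!] and the other factors cancel; [nodal] contributes the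
    same sign. *)
Lemma Kpoly_monic_size (R : realFieldType) (N : nat) (p : R) (n : nat) :
  p != 0 -> (n <= N)%N -> Kpoly N p n \is monic /\ size (Kpoly N p n) = n.+1.
Proof.
move=> p0 le_nN; rewrite /Kpoly big_ord_recr /= addrC.
set S := (X in _ + X); set c := (X in X *: _ + _).
have c1 : c * (-1) ^+ n = 1.
  have h1 : (-1) ^+ n * (-1) ^+ n = 1 :> R by rewrite -expr2 sqrr_sign.
  have h2 := @poch_oppn_neq0 R _ _ le_nN.
  have h3 : n`!%:R != 0 :> R by rewrite pnatr_eq0 -lt0n fact_gt0.
  have h4 : p ^+ n != 0 by rewrite expf_neq0.
  rewrite /c [poch (- n%:R) n]poch_oppn ffactnn -[RHS]h1.
  move: (poch _ n) (n`!%:R) (p ^+ n) h2 h3 h4 => a b d h2 h3 h4.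
  by field; rewrite h2 h3 h4.
have c0 : c != 0.
  by apply/eqP => E; move: c1; rewrite E mul0r => /eqP; rewrite eq_sym oner_eq0.
have sc : size (c *: nodal (fun i => i%:R) n) = n.+1.
  by rewrite size_scale // size_nodal.
have sS : (size S < size (c *: nodal (fun i => i%:R) n)%R)%N.
  by rewrite sc ltnS /S; exact: (@size_sum_nodal R n (fun k => p ^+ n * poch (- N%:R) n *
    (poch (- n%:R) k / (poch (- N%:R) k * k`!%:R) * p ^- k))).
split; last by rewrite size_polyDl.
by apply/monicP; rewrite lead_coefDl // lead_coefZ lead_coef_nodal c1.
Qed.

Lemma sub_lead_size (R : realFieldType) (f g : {poly R}) (m : nat) :
  (size f <= m.+1)%N -> (size g <= m.+1)%N -> f`_m = g`_m -> (size (f - g)%R <= m)%N.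
Proof.
move=> sf sg e; apply/leq_sizeP => i; rewrite leq_eqVlt => /orP[/eqP <-|lt_mi].
  by rewrite coefB e subrr.
by rewrite coefB !nth_default ?subrr // (leq_trans _ lt_mi).
Qed.

Lemma sub_scale_size (R : realFieldType) (f g : {poly R}) (m : nat) :
  (size f <= m.+1)%N -> size g = m.+1 ->
  (size (f - (f`_m / lead_coef g) *: g)%R <= m)%N.
Proof.
move=> sf sg; apply: sub_lead_size => //.
  by apply: leq_trans (size_scale_leq _ _) _; rewrite sg.
have e : g`_m = lead_coef g by rewrite lead_coefE sg.
rewrite coefZ e divfK //.
by rewrite lead_coef_eq0 -size_poly_eq0 sg.
Qed.

(** * The binomial inner product, orthogonality and Fourier expansion *)

Definition wip (R : realFieldType) (N : nat) (p : R) (f g : {poly R}) : R :=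
  \sum_(x < N.+1) f.[x%:R] * g.[x%:R] * wbin N p x.

Lemma wipC (R : realFieldType) (N : nat) (p : R) (f g : {poly R}) :
  wip N p f g = wip N p g f.
Proof. by apply: eq_bigr => x _; rewrite (mulrC f.[_]). Qed.

Lemma wipDr (R : realFieldType) (N : nat) (p : R) (f g h : {poly R}) :
  wip N p f (g + h) = wip N p f g + wip N p f h.
Proof.
by rewrite /wip -big_split; apply: eq_bigr => x _; rewrite /= hornerD; ring.
Qed.

Lemma wipZr (R : realFieldType) (N : nat) (p a : R) (f g : {poly R}) :
  wip N p f (a *: g) = a * wip N p f g.
Proof.
by rewrite /wip mulr_sumr; apply: eq_bigr => x _; rewrite hornerZ; ring.
Qed.

Lemma wipBl (R : realFieldType) (N : nat) (p : R) (f g h : {poly R}) :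
  wip N p (g - h) f = wip N p g f - wip N p h f.
Proof. by rewrite -scaleN1r wipC wipDr wipZr mulN1r !(wipC _ _ f). Qed.

Lemma wipZl (R : realFieldType) (N : nat) (p a : R) (f g : {poly R}) :
  wip N p (a *: g) f = a * wip N p g f.
Proof. by rewrite wipC wipZr wipC. Qed.

Lemma wip_sumZl (R : realFieldType) (N : nat) (p : R) (m : nat) (a : nat -> R)
    (F : nat -> {poly R}) (f : {poly R}) :
  wip N p (\sum_(k < m) a k *: F k) f = \sum_(k < m) a k * wip N p (F k) f.
Proof.
elim: m => [|m IHm].
  by rewrite !big_ord0 /wip big1 // => x _; rewrite horner0 !mul0r.
by rewrite !big_ord_recr /= wipC wipDr wipZr !(wipC _ _ f) IHm.
Qed.

Lemma wip_mulX (R : realFieldType) (N : nat) (p : R) (f g : {poly R}) :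
  wip N p ('X * f) g = wip N p f ('X * g).
Proof. by apply: eq_bigr => x _; rewrite !hornerM !hornerX; ring. Qed.

(** A family with one member in each degree below [n] spans: subtracting a multiple of [g n] removes
    the top coefficient of [q], and induction handles the rest. *)
Lemma wip_graded_orth (R : realFieldType) (N : nat) (p : R) (f : {poly R})
    (g : nat -> {poly R}) (n : nat) :
  (forall m, (m < n)%N -> size (g m) = m.+1) ->
  (forall m, (m < n)%N -> wip N p f (g m) = 0) ->
  forall q : {poly R}, (size q <= n)%N -> wip N p f q = 0.
Proof.
elim: n => [|n IHn] sg og q sq.
  rewrite leqn0 size_poly_eq0 in sq; rewrite (eqP sq) /wip big1 // => x _.
  by rewrite horner0 mulr0 mul0r.
rewrite -(subrK ((q`_n / lead_coef (g n)) *: g n) q) wipDr wipZr og // mulr0 addr0.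
apply: IHn => [m lt_m|m lt_m|]; [exact/sg/ltnW|exact/og/ltnW|].
by apply: sub_scale_size => //; apply: sg.
Qed.

Lemma wbin_gt0 (R : realFieldType) (N : nat) (p : R) (x : nat) :
  0 < p -> p < 1 -> (x <= N)%N -> 0 < wbin N p x.
Proof.
move=> p0 p1 h; rewrite /wbin !mulr_gt0 ?exprn_gt0 ?subr_gt0 //.
by rewrite ltr0n bin_gt0.
Qed.

(** If the sum of nonnegative terms were zero, [f] would vanish at the [N.+1] points of the support,
    more than its degree allows. *)
Lemma wip_gt0 (R : realFieldType) (N : nat) (p : R) (f : {poly R}) :
  0 < p -> p < 1 -> (size f <= N.+1)%N -> f != 0 -> 0 < wip N p f f.
Proof.
move=> p0 p1 sf f0.
have ge0 (i : 'I_N.+1) : true -> 0 <= f.[i%:R] * f.[i%:R] * wbin N p i.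
  by move=> _; rewrite -expr2 mulr_ge0 ?sqr_ge0 // ltW // wbin_gt0 // -ltnS.
rewrite lt_neqAle sumr_ge0 // andbT eq_sym; apply: contraNneq f0 => /psumr_eq0P h0.
apply/eqP/(@roots_geq_poly_eq0 _ _ [seq (i%:R : R) | i <- iota 0 N.+1]).
- apply/allP => y /mapP[i]; rewrite mem_iota add0n => lt_iN -> {y}.
  have /eqP := h0 ge0 (Ordinal lt_iN) isT.
  by rewrite mulf_eq0 (gt_eqF (wbin_gt0 p0 p1 _)) // orbF mulf_eq0 orbb.
- by rewrite map_inj_uniq ?iota_uniq // => a b /eqP; rewrite eqr_nat => /eqP.
- by rewrite size_map size_iota.
Qed.

Lemma knorm2E (R : realFieldType) (N : nat) (p : R) (n : nat) :
  knorm2 N p n = wip N p (Kpoly N p n) (Kpoly N p n).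
Proof. by apply: eq_bigr => x _; rewrite horner_Kpoly expr2. Qed.

Lemma knorm2_gt0 (R : realFieldType) (N : nat) (p : R) (n : nat) :
  0 < p -> p < 1 -> (n <= N)%N -> 0 < knorm2 N p n.
Proof.
move=> p0 p1 le_nN; have [mK sK] := Kpoly_monic_size (lt0r_neq0 p0) le_nN.
by rewrite knorm2E wip_gt0 // ?sK // monic_neq0.
Qed.

(* The falling factorials of N - x have explicit mixed moments with those of x,
   and they turn the inner product into an n-th finite difference. *)
Lemma Kpoly_orth (R : realFieldType) (N : nat) (p : R) (n : nat) (q : {poly R}) :
  p != 0 -> (n <= N)%N -> (size q <= n)%N -> wip N p (Kpoly N p n) q = 0.
Proof.
move=> p0 le_nN; apply: (@wip_graded_orth R N p _ (nodal (fun i => N%:R - i%:R))).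
  by move=> m _; rewrite size_nodal.
move=> m lt_mn.
(* At the points of the support the test polynomial takes the values that occur in [wbin_moment]. *)
have ev (x : 'I_N.+1) : (nodal (fun i => N%:R - i%:R : R) m).[x%:R] = ((N - x) ^_ m)%:R.
  have le_xN : (x <= N)%N by rewrite -ltnS.
  transitivity (poch (- (N - x)%N%:R : R) m * (-1) ^+ m).
    rewrite nodalE hornerZ mulrC horner_prod /poch; congr (_ * _).
    by apply: eq_bigr => i _; rewrite natrB // !hornerE; ring.
  by rewrite poch_oppn mulrAC -expr2 sqrr_sign mul1r.
transitivity (p ^+ n * poch (- N%:R) n * \sum_(k < n.+1)
    (-1) ^+ k * 'C(n, k)%:R / (N ^_ k)%:R * p ^- k *
    \sum_(x < N.+1) (x ^_ k)%:R * ((N - x) ^_ m)%:R * wbin N p x).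
  under [in RHS]eq_bigr do rewrite mulr_sumr.
  rewrite exchange_big /= mulr_sumr; apply: eq_bigr => x _.
  rewrite ev horner_Kpoly /Kraw -!mulrA; do 2!congr (_ * _).
  rewrite mulr_suml; apply: eq_bigr => -[k] /= lt_kn _.
  rewrite !poch_oppn -bin_ffact natrM.
  have h1 : (-1) ^+ k * (-1) ^+ k = 1 :> R by rewrite -expr2 sqrr_sign.
  have h3 : k`!%:R != 0 :> R by rewrite pnatr_eq0 -lt0n fact_gt0.
  have h2 : (N ^_ k)%:R != 0 :> R.
    by rewrite pnatr_eq0 -lt0n ffact_gt0 (leq_trans _ le_nN).
  have h4 : (-1) ^+ k != 0 :> R by rewrite expf_neq0 // oppr_eq0 oner_eq0.
  have h5 : p ^+ k != 0 by rewrite expf_neq0.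
  move: ((-1) ^+ k) (k`!%:R) ((N ^_ k)%:R) (p ^+ k) h1 h2 h3 h4 h5.
  by move=> a b c d h1 h2 h3 h4 h5; field; rewrite h2 h3 h4 h5.
apply/eqP; rewrite mulf_eq0; apply/orP; right; apply/eqP.
(* The moment produces the factors [N ^_ k] and [p ^+ k], which cancel the denominators and leave an
   alternating binomial sum. *)
under eq_bigr do rewrite wbin_moment ffactnD -[((N - _) ^_ m)%N]bin_ffact !natrM.
transitivity (m`!%:R * (1 - p) ^+ m *
    \sum_(k < n.+1) (-1) ^+ k * 'C(n, k)%:R * 'C(N - k, m)%:R).
  rewrite mulr_sumr; apply: eq_bigr => -[k] /= lt_kn _.
  have h2 : (N ^_ k)%:R != 0 :> R.
    by rewrite pnatr_eq0 -lt0n ffact_gt0 (leq_trans _ le_nN).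
  have h5 : p ^+ k != 0 by rewrite expf_neq0.
  by move: ((N ^_ k)%:R) (p ^+ k) h2 h5 => a b h2 h5; field; rewrite h2 h5.
by rewrite alternating_bin_sum // mulr0.
Qed.

Lemma Kpoly_orth_neq (R : realFieldType) (N : nat) (p : R) (k l : nat) :
  p != 0 -> (k <= N)%N -> (l <= N)%N -> k != l ->
  wip N p (Kpoly N p k) (Kpoly N p l) = 0.
Proof.
move=> p0 le_kN le_lN; rewrite neq_ltn => /orP[lt_kl|lt_lk].
  by rewrite wipC Kpoly_orth // (Kpoly_monic_size p0 le_kN).2.
by rewrite Kpoly_orth // (Kpoly_monic_size p0 le_lN).2.
Qed.

(** Such an [f] is orthogonal to its whole degree range, hence to itself, and definiteness applies
    because [m <= N.+1]. *)
Lemma orth_Kpoly_eq0 (R : realFieldType) (N : nat) (p : R) (m : nat) (f : {poly R}) :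
  0 < p -> p < 1 -> (m <= N.+1)%N -> (size f <= m)%N ->
  (forall k, (k < m)%N -> wip N p f (Kpoly N p k) = 0) -> f = 0.
Proof.
move=> p0 p1 le_mN sf orth_f; apply/eqP; apply: contraT => f0.
have := wip_gt0 p0 p1 (leq_trans sf le_mN) f0.
rewrite (wip_graded_orth _ orth_f) ?ltxx // => k lt_km.
by rewrite (Kpoly_monic_size (lt0r_neq0 p0) _).2 // -ltnS (leq_trans lt_km).
Qed.

Lemma Kpoly_expansion (R : realFieldType) (N : nat) (p : R) (m : nat) (f : {poly R}) :
  0 < p -> p < 1 -> (m <= N.+1)%N -> (size f <= m)%N ->
  f = \sum_(k < m) (wip N p f (Kpoly N p k) / knorm2 N p k) *: Kpoly N p k.
Proof.
move=> p0 p1 le_mN sf; have pn0 := lt0r_neq0 p0.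
have le_N k : (k < m)%N -> (k <= N)%N by move=> h; rewrite -ltnS (leq_trans h).
apply/eqP; rewrite -subr_eq0; apply/eqP; apply: (orth_Kpoly_eq0 p0 p1 le_mN).
  rewrite (leq_trans (size_polyD _ _)) // geq_max sf size_polyN /=.
  apply: leq_trans (size_sum _ _ _) _; apply/bigmax_leqP => -[i lt_im] _ /=.
  apply: leq_trans (size_scale_leq _ _) _.
  by rewrite (Kpoly_monic_size pn0 (le_N _ lt_im)).2.
move=> k lt_km.
rewrite wipBl (wip_sumZl _ _ _ (fun k => wip N p f (Kpoly N p k) / knorm2 N p k)).
rewrite (bigD1 (Ordinal lt_km)) //= big1 => [|i ne_ik].
  by rewrite addr0 -knorm2E divfK ?subrr // gt_eqF // knorm2_gt0 // le_N.
by rewrite Kpoly_orth_neq ?mulr0 ?le_N.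
Qed.

(** The difference of [f] and [Kpoly N p n] has degree below [n], so it is invisible to
    [Kpoly N p n]. *)
Lemma wip_monic_Kpoly (R : realFieldType) (N : nat) (p : R) (n : nat) (f : {poly R}) :
  p != 0 -> (n <= N)%N -> f \is monic -> size f = n.+1 ->
  wip N p (Kpoly N p n) f = knorm2 N p n.
Proof.
move=> p0 le_nN mf sf; have [mK sK] := Kpoly_monic_size p0 le_nN.
rewrite knorm2E -[in LHS](subrK (Kpoly N p n) f) wipDr Kpoly_orth ?add0r //.
apply: sub_lead_size; rewrite ?sf ?sK //.
by move/monicP: mf; move/monicP: mK; rewrite !lead_coefE sf sK /= => -> ->.
Qed.

(** * The three-term recurrence and the Christoffel-Darboux formula *)

Lemma Kpoly_three_term (R : realFieldType) (N : nat) (p : R) (n : nat) :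
  0 < p -> p < 1 -> (n.+2 <= N)%N -> exists a : R,
  'X * Kpoly N p n.+1 = Kpoly N p n.+2 + a *: Kpoly N p n.+1
    + (knorm2 N p n.+1 / knorm2 N p n) *: Kpoly N p n.
Proof.
move=> p0 p1 le_nN; have pn0 := lt0r_neq0 p0.
have le1 : (n.+1 <= N)%N := ltnW le_nN; have le0 : (n <= N)%N := ltnW le1.
have [mK sK] := Kpoly_monic_size pn0 le1.
have [mK2 sK2] := Kpoly_monic_size pn0 le_nN.
have [mK0 sK0] := Kpoly_monic_size pn0 le0.
have sX (k : nat) (f : {poly R}) : f \is monic -> size f = k.+1 -> size ('X * f) = k.+2.
  by move=> mf sf; rewrite size_monicM ?monicX ?monic_neq0 // size_polyX sf.
have mX (f : {poly R}) : f \is monic -> 'X * f \is monic.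
  by move=> mf; rewrite monicMr ?monicX.
pose a := wip N p ('X * Kpoly N p n.+1) (Kpoly N p n.+1) / knorm2 N p n.+1.
exists a; apply/eqP; rewrite -subr_eq0; apply/eqP.
have E : 'X * Kpoly N p n.+1 - (Kpoly N p n.+2 + a *: Kpoly N p n.+1
    + (knorm2 N p n.+1 / knorm2 N p n) *: Kpoly N p n) =
  ('X * Kpoly N p n.+1 - Kpoly N p n.+2) - a *: Kpoly N p n.+1
    - (knorm2 N p n.+1 / knorm2 N p n) *: Kpoly N p n by rewrite !opprD !addrA.
(* The leading terms cancel, so the defect has degree at most [n.+1], and orthogonality to each
   [Kpoly N p k] with [k < n.+2] suffices. *)
rewrite E; apply: (@orth_Kpoly_eq0 _ N _ n.+2 _ p0 p1); first exact: leqW.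
  rewrite (leq_trans (size_polyD _ _)) // geq_max size_polyN.
  rewrite (leq_trans (size_polyD _ _)) ?geq_max ?size_polyN.
    by rewrite (leq_trans (size_scale_leq _ _)) // sK0.
  rewrite (leq_trans (size_scale_leq _ _)) ?sK // andbT.
  apply: sub_lead_size; rewrite ?sK2 ?(sX n.+1) //.
  have /monicP := mX _ mK; move/monicP: mK2.
  by rewrite !lead_coefE sK2 (sX n.+1) //= => -> ->.
have h0 : knorm2 N p n != 0 by rewrite gt_eqF // knorm2_gt0.
have h1 : knorm2 N p n.+1 != 0 by rewrite gt_eqF // knorm2_gt0.
move=> k; rewrite !wipBl !wipZl ltnS leq_eqVlt => /orP[/eqP->|].
  rewrite (Kpoly_orth_neq pn0 le_nN) // ?gtn_eqF // (Kpoly_orth_neq pn0 le0) ?ltn_eqF //.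
  by rewrite -knorm2E /a divfK // !subr0 mulr0 subrr subr0.
(* For [k <= n] the factor ['X] moves to the other argument. At [k = n] this gives a monic
   polynomial of degree [n.+1], whence the ratio of norms; for [k < n] the degree stays below
   [n.+1]. *)
rewrite ltnS leq_eqVlt => /orP[/eqP->|lt_kn].
  rewrite wip_mulX (wip_monic_Kpoly (n := n.+1)) ?(sX n) ?mX //.
  rewrite (Kpoly_orth_neq pn0 le_nN le0) ?(Kpoly_orth_neq pn0 le1 le0) ?gtn_eqF //.
  rewrite -knorm2E divfK //.
  by rewrite !subr0 mulr0 subr0 subrr.
have le_kN := ltnW (leq_trans lt_kn le0).
have [mKk sKk] := Kpoly_monic_size pn0 le_kN.
rewrite wip_mulX Kpoly_orth ?(sX k) //.
have lt_kn2 : (k < n.+2)%N := leqW (leqW lt_kn).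
rewrite !(Kpoly_orth_neq pn0) // ?gtn_eqF ?(leqW lt_kn) //.
by rewrite !mulr0 !subr0.
Qed.

(** Induction on [n]: the base case is explicit, and in the step the recurrence eliminates degree
    [n.+2] at both points, after which the terms in [a] cancel. *)
Lemma christoffel_darboux (R : realFieldType) (N : nat) (p : R) (n : nat) (x y : R) :
  0 < p -> p < 1 -> (n < N)%N ->
  (x - y) * kern N p n.+1 0 0 x y =
  (Kraw N p n.+1 x * Kraw N p n y - Kraw N p n x * Kraw N p n.+1 y) / knorm2 N p n.
Proof.
move=> p0 p1; elim: n => [|n IHn] lt_nN.
  have N0 : N%:R != 0 :> R by rewrite pnatr_eq0 -lt0n.
  have pn0 := lt0r_neq0 p0.
  rewrite /kern big_ord1 !fdiffn0 mulrA; congr (_ / _).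
  rewrite /Kraw !big_ord_recl !big_ord0 /= /bump /= /poch !big_ord_recl !big_ord0.
  rewrite /= !factS fact0 expr0 expr1 /=.
  by field; rewrite N0 pn0.
have h0 : knorm2 N p n != 0 by rewrite gt_eqF // knorm2_gt0 // ltnW // ltnW.
have h1 : knorm2 N p n.+1 != 0 by rewrite gt_eqF // knorm2_gt0 // ltnW.
rewrite /kern big_ord_recr /= mulrDr [X in X + _]IHn ?(ltnW lt_nN) // !fdiffn0.
have [a E] := Kpoly_three_term p0 p1 lt_nN.
have ev z : z * Kraw N p n.+1 z = Kraw N p n.+2 z + a * Kraw N p n.+1 z
    + knorm2 N p n.+1 / knorm2 N p n * Kraw N p n z.
  by rewrite -!horner_Kpoly -{1}[z]hornerX -hornerM E !hornerD !hornerZ.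
have e2 z : Kraw N p n.+2 z = z * Kraw N p n.+1 z - a * Kraw N p n.+1 z
    - knorm2 N p n.+1 / knorm2 N p n * Kraw N p n z by rewrite ev; ring.
by rewrite !e2; field; rewrite h0 h1.
Qed.

(** Christoffel-Darboux exhibits the kernel as a quotient by [x - y], so [fdiffn_quotient] in the
    variable [y] yields both coefficients at once. *)
Lemma kern_scrAB (R : realFieldType) (N : nat) (p : R) (j n : nat) (x y : R) :
  0 < p -> p < 1 -> (0 < n)%N -> (n <= N)%N -> ffact (x - y) j.+1 != 0 ->
  kern N p n 0 j x y =
  scrA N p j n x y * Kraw N p n x + scrB N p j n x y * Kraw N p n.-1 x.
Proof.
move=> p0 p1; case: n => [//|n] _ lt_nN ff0.
have h0 : knorm2 N p n != 0 by rewrite gt_eqF // knorm2_gt0 // ltnW.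
have fg z := christoffel_darboux x z p0 p1 lt_nN.
have L : fdiffn j (kern N p n.+1 0 0 x) y = kern N p n.+1 0 j x y.
  rewrite (@fdiffn_ext _ _ _ (fun z => \sum_(k < n.+1)
    (Kraw N p k x / knorm2 N p k) * Kraw N p k z)); last first.
    by move=> z; apply: eq_bigr => k _; rewrite !fdiffn0 mulrAC.
  rewrite (fdiffn_sum _ _ (fun k => Kraw N p k x / knorm2 N p k)).
  by apply: eq_bigr => k _; rewrite fdiffn0 mulrAC.
have := fdiffn_quotient fg j y; rewrite L => /(canRL (mulKf ff0)) ->.
under eq_bigr => k _.
  (* The final [+ 0] lets [fdiffn_linear] apply to each of the two terms. *)
  rewrite (@fdiffn_ext _ _ _ (fun z => Kraw N p n.+1 x / knorm2 N p n * Kraw N p n z +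
    (- (Kraw N p n x / knorm2 N p n) * Kraw N p n.+1 z + 0))); last first.
    by move=> z; field.
  rewrite !fdiffn_linear.
  over.
rewrite /scrA /scrB /= [LHS]mulrA.
have z0 k : fdiffn k (fun=> 0 : R) y = 0.
  by elim: k (y) => [|k IHk] z //; rewrite fdiffnS !IHk subrr.
transitivity ((ffact (x - y) j.+1)^-1 * j`!%:R * (Kraw N p n.+1 x / knorm2 N p n *
    (\sum_(k < j.+1) fdiffn k (Kraw N p n) y / k`!%:R * ffact (x - y) k) -
    Kraw N p n x / knorm2 N p n *
    (\sum_(k < j.+1) fdiffn k (Kraw N p n.+1) y / k`!%:R * ffact (x - y) k))).
  congr (_ * _); rewrite !mulr_sumr -sumrB; apply: eq_bigr => k _.
  by rewrite z0; ring.
by field; rewrite ff0 h0.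
Qed.

(** * Positivity of the determinant [deltan] *)

Lemma kernC (R : realFieldType) (N : nat) (p : R) (n i : nat) (x y : R) :
  kern N p n i i x y = kern N p n i i y x.
Proof. by apply: eq_bigr => k _; rewrite (mulrC (fdiffn _ _ x)). Qed.

Lemma kern_ge0 (R : realFieldType) (N : nat) (p : R) (n i : nat) (x : R) :
  0 < p -> p < 1 -> (n <= N.+1)%N -> 0 <= kern N p n i i x x.
Proof.
move=> p0 p1 le_nN; apply: sumr_ge0 => -[k] /= lt_kn _.
by rewrite -expr2 mulr_ge0 ?sqr_ge0 // invr_ge0 ltW // knorm2_gt0 // -ltnS (leq_trans lt_kn).
Qed.

(** The form is a sum of squares divided by squared norms; it is the source of the Cauchy-Schwarz
    inequality for the kernel. *)
Lemma kern_quad_ge0 (R : realFieldType) (N : nat) (p : R) (n i : nat) (x y s t : R) :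
  0 < p -> p < 1 -> (n <= N.+1)%N ->
  0 <= s ^+ 2 * kern N p n i i x x + 2 * s * t * kern N p n i i x y
       + t ^+ 2 * kern N p n i i y y.
Proof.
move=> p0 p1 le_nN; rewrite /kern !mulr_sumr -!big_split /=.
apply: sumr_ge0 => -[k] /= lt_kn _.
rewrite [leRHS](_ : _ = (s * fdiffn i (Kraw N p k) x + t * fdiffn i (Kraw N p k) y) ^+ 2
  / knorm2 N p k); last by ring.
by rewrite mulr_ge0 ?sqr_ge0 // invr_ge0 ltW // knorm2_gt0 // -ltnS (leq_trans lt_kn).
Qed.

Lemma deltan_gt0 (R : realFieldType) (N : nat) (p lam mu : R) (j n : nat) :
  0 < p -> p < 1 -> 0 <= lam -> 0 <= mu -> (n <= N.+1)%N ->
  0 < deltan N p lam mu j n.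
Proof.
move=> p0 p1 l0 m0 le_nN; rewrite /deltan /kN0 kernC -/(k0N N p j n).
have A0 : 0 <= k00 N p j n by exact: kern_ge0.
have B0 : 0 <= kNN N p j n by exact: kern_ge0.
have Q s t : 0 <= s ^+ 2 * k00 N p j n + 2 * s * t * k0N N p j n + t ^+ 2 * kNN N p j n.
  exact: kern_quad_ge0.
move: (k00 N p j n) (k0N N p j n) (kNN N p j n) A0 B0 Q => A C B A0 B0 Q.
have CS : C ^+ 2 <= A * B.
  case: (eqVneq A 0) => [A00|An0].
    rewrite A00 mul0r; case: (eqVneq C 0) => [->|Cn0]; first by rewrite expr0n.
    (* With [A = 0] the form at [t = 1] is [2 * s * C + B]; this [s] makes it [-1], a
       contradiction. *)
    have := Q (- (B + 1) / (2 * C)) 1; rewrite A00.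
    rewrite [leRHS](_ : _ = -1); last by field.
    by rewrite ler0N1.
  have Apos : 0 < A by rewrite lt_neqAle eq_sym An0.
  have := Q (- C) A.
  rewrite [leRHS](_ : _ = A * (A * B - C ^+ 2)); last by ring.
  by rewrite pmulr_rge0 // subr_ge0.
have h1 : 0 <= lam * A by rewrite mulr_ge0.
have h2 : 0 <= mu * B by rewrite mulr_ge0.
have h3 : 0 <= lam * mu * (A * B - C ^+ 2) by rewrite !mulr_ge0 // subr_ge0.
rewrite [ltRHS](_ : _ = 1 + (lam * A + mu * B + lam * mu * (A * B - C ^+ 2))); last by ring.
by rewrite ltr_pwDl // !addr_ge0.
Qed.

(** * The connection formula for the Kravchuk-Sobolev polynomial *)

(** Sobolev orthogonality to [Kpoly N p k] expresses each Fourier coefficient of [P] below degree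
    [n] through its two [j]-th differences. The order [i] is free: [i = j] gives the linear system,
    [i = 0] the polynomial itself. *)
Lemma sobolev_expansion (R : realFieldType) (N n j : nat) (p lam mu : R) (P : {poly R}) :
  0 < p -> p < 1 -> (n <= N)%N -> P \is monic -> size P = n.+1 ->
  (forall q : {poly R}, (size q <= n)%N -> sobip N p lam mu j P q = 0) ->
  forall i z, fdiffn i (horner P) z = fdiffn i (Kraw N p n) z
    - lam * fdiffn j (horner P) 0 * kern N p n i j z 0
    - mu * fdiffn j (horner P) N%:R * kern N p n i j z N%:R.
Proof.
move=> p0 p1 le_nN mP sP oP i z; have pn0 := lt0r_neq0 p0.
have [mK sK] := Kpoly_monic_size pn0 le_nN.
set u := fdiffn j _ 0; set v := fdiffn j _ N%:R.
pose a k : R := - (lam * u * fdiffn j (Kraw N p k) 0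
  + mu * v * fdiffn j (Kraw N p k) N%:R) / knorm2 N p k.
have sD : (size (P - Kpoly N p n)%R <= n)%N.
  apply: sub_lead_size; rewrite ?sP ?sK //.
  by move/monicP: mP; move/monicP: mK; rewrite !lead_coefE sP sK /= => -> ->.
have PE : P = Kpoly N p n + \sum_(k < n) a k *: Kpoly N p k.
  rewrite -[LHS](subrKC (Kpoly N p n)); congr (_ + _).
  rewrite [LHS](Kpoly_expansion p0 p1 (leqW le_nN) sD).
  apply: eq_bigr => -[k] /= lt_kn _; congr ((_ / _) *: _).
  have le_kN := ltnW (leq_trans lt_kn le_nN).
  have sKk := (Kpoly_monic_size pn0 le_kN).2.
  rewrite wipBl (Kpoly_orth_neq pn0) ?gtn_eqF // subr0.
  have := oP (Kpoly N p k); rewrite sKk => /(_ lt_kn).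
  rewrite /sobip -/(wip N p P (Kpoly N p k)) -/u -/v.
  rewrite !(fdiffn_ext _ (horner_Kpoly N p k)).
  by move/eqP; rewrite -addrA addr_eq0 => /eqP.
have ev y : P.[y] = 1 * Kraw N p n y + \sum_(k < n) a k * Kraw N p k y.
  rewrite {1}PE hornerD horner_Kpoly horner_sum mul1r; congr (_ + _).
  by apply: eq_bigr => k _; rewrite hornerZ horner_Kpoly.
rewrite (fdiffn_ext _ ev) fdiffn_linear fdiffn_sum mul1r -!addrA; congr (_ + _).
rewrite /kern !mulr_sumr -!sumrN -big_split /=.
by apply: eq_bigr => k _; rewrite /a; ring.
Qed.

(* Differencing the expansion at 0 and at N gives a 2x2 linear system with
   determinant [deltan]; Cramer's rule identifies its solution. *)
Lemma sobolev_fdiffn (R : realFieldType) (N n j : nat) (p lam mu : R) (P : {poly R}) :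
  0 < p -> p < 1 -> 0 <= lam -> 0 <= mu -> (n <= N)%N ->
  P \is monic -> size P = n.+1 ->
  (forall q : {poly R}, (size q <= n)%N -> sobip N p lam mu j P q = 0) ->
  fdiffn j (horner P) 0 = Phi1 N p lam mu j n /\
  fdiffn j (horner P) N%:R = Phi2 N p lam mu j n.
Proof.
move=> p0 p1 l0 m0 le_nN mP sP oP.
have dn : deltan N p lam mu j n != 0.
  by rewrite gt_eqF // deltan_gt0 // leqW.
have E0 := sobolev_expansion p0 p1 le_nN mP sP oP j 0.
have EN := sobolev_expansion p0 p1 le_nN mP sP oP j N%:R.
rewrite -/(k00 N p j n) -/(k0N N p j n) -/(d0 N p j n) in E0.
rewrite -/(kN0 N p j n) -/(kNN N p j n) -/(dN N p j n) in EN.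
have e0 : d0 N p j n = fdiffn j (horner P) 0
    + lam * fdiffn j (horner P) 0 * k00 N p j n
    + mu * fdiffn j (horner P) N%:R * k0N N p j n by rewrite {1}E0; ring.
have eN : dN N p j n = fdiffn j (horner P) N%:R
    + lam * fdiffn j (horner P) 0 * kN0 N p j n
    + mu * fdiffn j (horner P) N%:R * kNN N p j n by rewrite {1}EN; ring.
by rewrite /Phi1 /Phi2 e0 eN; split; apply/(canRL (mulfK dn)); rewrite /deltan; ring.
Qed.

Lemma sobolev_connection (R : realFieldType) (N n j : nat) (p lam mu : R)
    (P : {poly R}) (x : R) :
  0 < p -> p < 1 -> 0 <= lam -> 0 <= mu -> (0 < n)%N -> (n <= N)%N ->
  P \is monic -> size P = n.+1 ->
  (forall q : {poly R}, (size q <= n)%N -> sobip N p lam mu j P q = 0) ->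
  ffact (x - 0) j.+1 != 0 -> ffact (x - N%:R) j.+1 != 0 ->
  P.[x] = C1 N p lam mu j n x * Kraw N p n x + D1 N p lam mu j n x * Kraw N p n.-1 x.
Proof.
move=> p0 p1 l0 m0 n0 le_nN mP sP oP ff0 ffN.
have := sobolev_expansion p0 p1 le_nN mP sP oP 0 x; rewrite !fdiffn0 => ->.
have [-> ->] := sobolev_fdiffn p0 p1 l0 m0 le_nN mP sP oP.
by rewrite !kern_scrAB // /C1 /D1; ring.
Qed.

(** * Pochhammer ratios and the hypergeometric form *)

Lemma poch_recl (R : realFieldType) (a : R) (k : nat) :
  poch a k.+1 = a * poch (a + 1) k.
Proof.
rewrite /poch big_ord_recl addr0; congr (_ * _).
by apply: eq_bigr => i _; rewrite /bump /= natrD addrA.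
Qed.

(** Peel [poch (a - 1) k.+1] at its first and at its last factor, and compare. *)
Lemma poch_ratio (R : realFieldType) (a : R) (k : nat) :
  a - 1 != 0 -> poch (a - 1) k != 0 ->
  poch a k / poch (a - 1) k = 1 + k%:R / (a - 1).
Proof.
move=> a0 pk0; have E : poch (a - 1) k * (a - 1 + k%:R) = (a - 1) * poch a k.
  by rewrite -pochS poch_recl subrK.
by apply/(canLR (mulfK pk0))/(mulfI a0); rewrite -E; field.
Qed.

(** This puts the terms of two consecutive Kravchuk sums over the same symbol
    [poch (- n.+1%:R) k]. *)
Lemma poch_opp_pred (R : realFieldType) (n k : nat) :
  n.+1%:R * poch (- n%:R : R) k = (n.+1%:R - k%:R) * poch (- n.+1%:R) k.
Proof.
have := poch_recl (- n.+1%:R : R) k.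
rewrite pochS (_ : - n.+1%:R + 1 = - n%:R :> R); last by rewrite -natr1; ring.
by move=> E; apply: oppr_inj; rewrite -!mulNr -E; ring.
Qed.

Unset Implicit Arguments.
Set Strict Implicit.

Theorem mainTheorem3 (R : realFieldType) (N n j : nat) (p lam mu : R)
  (hp0 : 0 < p) (hp1 : p < 1) (hlam : 0 < lam) (hmu : 0 < mu)
  (hn1 : (1 <= n)%N) (hnN : (n <= N)%N)
  (P : {poly R})
  (hPmon : P \is monic) (hPsize : size P = n.+1)
  (hPorth : forall q : {poly R}, (size q <= n)%N -> sobip N p lam mu j P q = 0)
  (x : R)
  (hdef0 : ffact (x - 0) j.+1 != 0) (hdefN : ffact (x - N%:R) j.+1 != 0)
  (hD : D1 N p lam mu j n x != 0)
  (hf : forall i : nat, (i < n)%N -> fn N p lam mu j n x - 1 != - i%:R) :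
  P.[x] =
  p ^+ n.-1 * poch (- N%:R) n.-1 * hn N p lam mu j n x *
  \sum_(k < n.+1)
     (poch (- n%:R) k * poch (- x) k * poch (fn N p lam mu j n x) k
       / (poch (- N%:R) k * poch (fn N p lam mu j n x - 1) k))
     * (p ^- k / k`!%:R).
Proof.
rewrite (sobolev_connection hp0 hp1 (ltW hlam) (ltW hmu) hn1 hnN hPmon hPsize hPorth) //.
case: n hn1 hnN hD hf {hPsize hPorth} => [//|m] _ le_mN hD hf /=.
set C := C1 _ _ _ _ _ _ _; set D := D1 _ _ _ _ _ _ _ in hD *.
set f := fn _ _ _ _ _ _ _ in hf *; set h := hn _ _ _ _ _ _ _.
have pn0 := lt0r_neq0 hp0.
have a0 : m.+1%:R != 0 :> R by rewrite pnatr_eq0.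
(* This relation makes the correction [k / (f - 1)] a multiple of [D / h], so the prefactor [h]
   clears it. *)
have fE : f - 1 = - m.+1%:R * h / D.
  rewrite /f /fn /h /hn -/C -/D; move: (m.+1%:R) a0 => a a0.
  by field; rewrite hD.
have hE : h = - (p * (N%:R - m.+1%:R + 1) * C - D) by [].
clearbody f h C D.
have f0 : f - 1 != 0 by have := hf 0%N isT; rewrite oppr0.
have h0 : h != 0.
  by apply: contraNneq f0 => h0; rewrite fE h0 mulr0 mul0r.
rewrite /Kraw pochS exprS.
(* The added term [k = m.+1] is zero, since [poch (- m%:R) m.+1] contains the factor
   [- m%:R + m%:R]; both sums now share one range and are compared termwise. *)
have -> : \sum_(k < m.+1) poch (- m%:R) k * poch (- x) k / (poch (- N%:R) k * k`!%:R)
    * p ^- k = \sum_(k < m.+2) poch (- m%:R) k * poch (- x) k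
    / (poch (- N%:R) k * k`!%:R) * p ^- k.
  by rewrite [in RHS]big_ord_recr /= [poch (- m%:R) m.+1]pochS addNr mulr0 !mul0r addr0.
rewrite !mulr_sumr -big_split /=; apply: eq_bigr => -[k] /= lt_k _.
have G0 : poch (f - 1) k != 0.
  apply/prodf_neq0 => -[i lt_ik] _ /=; rewrite addr_eq0; apply: hf.
  exact: leq_trans lt_ik lt_k.
have Z0 : poch (- N%:R : R) k != 0 by rewrite poch_oppn_neq0 // (leq_trans _ le_mN).
have W0 : k`!%:R != 0 :> R by rewrite pnatr_eq0 -lt0n fact_gt0.
have P0 : p ^+ k != 0 by rewrite expf_neq0.
have key : h * (poch f k / poch (f - 1) k) = h - k%:R * D / m.+1%:R.
  rewrite poch_ratio // fE; move: (m.+1%:R) a0 => a a0.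
  by field; rewrite h0 hD a0.
have X : poch (- m%:R : R) k = (m.+1%:R - k%:R) / m.+1%:R * poch (- m.+1%:R) k.
  by apply: (mulfI a0); rewrite poch_opp_pred; move: (m.+1%:R) a0 => a a0; field.
transitivity (p ^+ m * poch (- N%:R) m * (h * (poch f k / poch (f - 1) k)) *
  (poch (- m.+1%:R) k * poch (- x) k / (poch (- N%:R) k * k`!%:R) * p ^- k));
  last by move: (p ^+ k) P0 => b b0; field; rewrite G0 Z0 W0 b0.
rewrite key X hE.
(* Everything is expressed in the single nonzero quantity [m.+1%:R] before [field]. *)
have mE : m%:R = m.+1%:R - 1 :> R by rewrite -natr1 addrK.
rewrite mE; move: (m.+1%:R) a0 (p ^+ k) P0 => a a0 b b0.
by field; rewrite Z0 W0 b0 a0.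
Qed.
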